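(* Let $(u_k)$ be a sequence in $C_M$ that converges pointwise on the interior $\operatorname{int}\Omega$ to a function $u\in C_M$. Let $f:\mathbb{R}^{n*}\to\mathbb{R}$ be a bounded continuous function. Then $$\lim_{k\to\infty}\int_\Omega f(u_k'(x))\,dx=\int_\Omega f(u'(x))\,dx,$$ and all these integrals are defined and finite.
   Context: Let $\Omega\subset\mathbb{R}^n$ be a convex compact set with nonempty interior and let $M\ge0$. $\mathbb{R}^{n*}$ denotes the dual of the Euclidean space $\mathbb{R}^n$ (identified with $\mathbb{R}^n$). $C_M$ is the set of closed (i.e. lower semicontinuous) convex functions $u:\mathbb{R}^n\to\mathbb{R}\cup\{+\infty\}$ with $\operatorname{dom}u=\{x:u(x)<+\infty\}=\Omega$, $\inf u=0$, and $u\le M$ on $\Omega$. The gradient $u'(x)$ of a function $u\in C_M$ exists for almost every $x\in\Omega$. *)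

(* Defs.v *)
From HB Require Import structures.
From mathcomp Require Import all_boot all_order all_algebra.
From mathcomp Require Import all_classical all_reals all_analysis.
From mathcomp Require Import measurable_realfun lra.

Set Implicit Arguments.
Unset Strict Implicit.
Unset Printing Implicit Defensive.

Import Order.TTheory GRing.Theory Num.Theory.
Import numFieldNormedType.Exports.

Local Open Scope classical_set_scope.
Local Open Scope ring_scope.

Section borel_rV.
Context (R : realType) (n : nat).
Local Notation borel := (<<s @open 'rV[R]_n >>).

Let borel0 : borel set0. Proof. exact: sigma_algebra0. Qed.
Let borelC A : borel A -> borel (~` A). Proof. exact: sigma_algebraC. Qed.
Let borelU (F : (set 'rV[R]_n)^nat) :
  (forall i, borel (F i)) -> borel (\bigcup_i F i).
Proof. exact: sigma_algebra_bigcup. Qed.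

HB.instance Definition _ := @isMeasurable.Build (sigma_display (@open 'rV[R]_n))
  'rV[R]_n borel borel0 borelC borelU.

Lemma open_measurable_rV (A : set 'rV[R]_n) : open A -> measurable A.
Proof. exact: sub_sigma_algebra. Qed.

Lemma open_rV_bigcup (A : set 'rV[R]_n) : open A ->
  A = \bigcup_(q in [set q : 'rV[rat]_n * rat |
                      ball (map_mx ratr q.1 : 'rV[R]_n) (ratr q.2) `<=` A])
        ball (map_mx ratr q.1 : 'rV[R]_n) (ratr q.2).
Proof.
move=> oA; apply/seteqP; split=> [x Ax|x [q /= qA]]; last exact: qA.
have [e /= e0 eA] : nbhs_ball x A by apply/nbhs_ballP; exact: open_nbhs_nbhs.
have [r] : exists r : rat, ratr r \in `]0, (e / 2)[%R.
  by apply: rat_in_itvoo; rewrite divr_gt0.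
rewrite in_itv/= => /andP[r0 re].
have /choice[q qP] : forall i : 'I_n, exists q : rat,
    ratr q \in `](x 0 i - ratr r), (x 0 i + ratr r)[%R.
  by move=> i; apply: rat_in_itvoo; lra.
have xq : ball (map_mx ratr (\row_i q i) : 'rV[R]_n) (ratr r) x.
  split=> // i j; rewrite ord1 !mxE.
  have := qP j; rewrite in_itv/= => /andP[q1 q2].
  by rewrite /ball/= ltr_norml; lra.
exists (\row_i q i, r) => //= y qy; apply: eA.
rewrite [e]splitr; apply: (@ball_triangle _ _ (map_mx ratr (\row_i q i) : 'rV[R]_n)).
  by apply: ball_sym; exact: le_ball (ltW re) _ xq.
exact: le_ball (ltW re) _ qy.
Qed.

Lemma measurable_fun_rVP d (T : measurableType d) (f : T -> 'rV[R]_n) :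
  measurable_fun [set: T] f <->
  forall i, measurable_fun [set: T] (fun x => f x 0 i : measurableTypeR R).
Proof.
split=> [mf i|mf].
  apply: (measurable_comp (F := [set: 'rV[R]_n])
    (f := fun v : 'rV[R]_n => v 0 i : measurableTypeR R)) => //.
  apply: (measurability _ (RGenOpens.measurableE R)).
  move=> _ [_ [a [b ->] <-]]; rewrite setTI; apply: open_measurable_rV.
  by apply: open_comp; [move=> v _; exact: coord_continuous|exact: interval_open].
apply: (measurability _ (erefl : measurable = <<s @open 'rV[R]_n >>)).
move=> _ [A oA <-]; rewrite setTI (open_rV_bigcup oA) preimage_bigcup.
rewrite bigcup_mkcond; apply: countable_bigcupT_measurable; first exact: countableP; move=> -[q r].
case: ifPn => _; last exact: measurable0.
rewrite (_ : _ @^-1` _ = if 0 < (ratr r : R) then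
   \bigcap_(i in [set: 'I_n]) [set x | ball (ratr (q 0 i) : R) (ratr r) (f x 0 i)]
   else set0); last first.
  apply/seteqP; split=> [x [/= r0 xq]|x]; case: ifPn => //=.
  - by move=> _ i _; have := xq 0 i; rewrite mxE.
  - by rewrite r0.
  - by move=> r0 xq; split=> // i j; rewrite ord1 mxE; exact: xq.
case: ifPn => _ //; apply: fin_bigcap_measurable => // i _.
rewrite -[X in measurable X]setTI; apply: (mf i measurableT).
apply: open_measurable; exact: ball_open.
Qed.

End borel_rV.

Section rV_cons.
Context (R : realType) (n : nat).

Definition rV_cons (p : measurableTypeR R * 'rV[R]_n) : 'rV[R]_n.+1 :=
  \row_i if unlift ord0 i is Some j then p.2 0 j else p.1.

Lemma rV_cons0 p : rV_cons p 0 ord0 = p.1.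
Proof. by rewrite mxE unlift_none. Qed.

Lemma rV_consS p i : rV_cons p 0 (lift ord0 i) = p.2 0 i.
Proof. by rewrite mxE liftK. Qed.

Definition rV_uncons (v : 'rV[R]_n.+1) : measurableTypeR R * 'rV[R]_n :=
  (v 0 ord0, \row_i v 0 (lift ord0 i)).

Lemma rV_consK : cancel rV_cons rV_uncons.
Proof.
move=> [x v]; rewrite /rV_uncons rV_cons0/=; congr pair.
by apply/rowP => i; rewrite mxE rV_consS.
Qed.

Lemma measurable_rV_cons : measurable_fun setT rV_cons.
Proof.
apply/measurable_fun_rVP => i; case: (unliftP ord0 i) => [j|] ->.
  apply: (eq_measurable_fun (fun p : measurableTypeR R * 'rV[R]_n => p.2 0 j : measurableTypeR R)).
    by move=> p _; rewrite rV_consS.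
  exact: (measurable_fun_rVP (@snd (measurableTypeR R) 'rV[R]_n)).1.
apply: (eq_measurable_fun (fun p : measurableTypeR R * 'rV[R]_n => p.1)); last exact: measurable_fst.
by move=> p _; rewrite rV_cons0.
Qed.

Lemma measurable_rV_uncons : measurable_fun setT rV_uncons.
Proof.
have mid : measurable_fun setT (@id 'rV[R]_n.+1) by exact: measurable_id.
apply: measurable_fun_pair; first exact: (measurable_fun_rVP _).1 mid ord0.
apply/measurable_fun_rVP => i.
apply: (eq_measurable_fun (fun v : 'rV[R]_n.+1 =>
  v 0 (lift ord0 i) : measurableTypeR R)); first by move=> v _; rewrite mxE.
exact: (measurable_fun_rVP _).1 mid _.
Qed.

Variable mu : {sigma_finite_measure set 'rV[R]_n -> \bar R}.

Definition rV_prod : set 'rV[R]_n.+1 -> \bar R :=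
  pushforward (lebesgue_measure \x mu)%E rV_cons.

HB.instance Definition _ := Measure.copy rV_prod
  (measure_function_pushforward__canonical__measure_function_Measure
    (lebesgue_measure \x mu)%E measurable_rV_cons).

Let rV_prod_sigma_finite : sigma_finite setT rV_prod.
Proof.
have /sigma_finiteP[F [TF ndF Foo]] := sigma_finiteT (@lebesgue_measure R).
have /sigma_finiteP[G [TG ndG Goo]] := sigma_finiteT mu.
exists (fun k => rV_uncons @^-1` (F k `*` G k)).
  rewrite -preimage_bigcup (_ : \bigcup_k _ = setT) ?preimage_setT//.
  rewrite -setXTT TF TG; apply/seteqP; split=> [[x y] [k _ []/= ? ?]|[x y]].
    by split; exists k.
  move=> [/= [k _ Fkx] [l _ Gly]]; exists (maxn k l) => //; split.
  - by move: x Fkx; exact/subsetPset/ndF/leq_maxl.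
  - by move: y Gly; exact/subsetPset/ndG/leq_maxr.
move=> k; have [mF Fk] := Foo k; have [mG Gk] := Goo k; split.
  rewrite -[X in measurable X]setTI; apply: measurable_rV_uncons => //.
  exact: measurableX.
rewrite /rV_prod /pushforward (_ : _ @^-1` _ = F k `*` G k); last first.
  by apply/seteqP; split=> p; rewrite /preimage /mkset rV_consK.
by rewrite product_measure1E// lte_mul_pinfty// ge0_fin_numE.
Qed.

HB.instance Definition _ :=
  Measure_isSigmaFinite.Build _ _ _ rV_prod rV_prod_sigma_finite.

End rV_cons.

(* Lebesgue measure on the Borel sets of R^n, as the n-fold product of the
   Lebesgue measure on R; lebesgue_rV_box is its value on boxes. *)
Fixpoint lebesgue_rV {R : realType} (n : nat) :
    {sigma_finite_measure set 'rV[R]_n -> \bar R} :=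
  match n with
  | 0 => \d_(0 : 'rV[R]_0)
  | n'.+1 => rV_prod (lebesgue_rV n')
  end.

Lemma measurable_rV_box (R : realType) (n : nat) (A : 'I_n -> set R) :
  (forall i, measurable (A i)) -> measurable [set v : 'rV[R]_n | forall i, A i (v 0 i)].
Proof.
move=> mA; rewrite (_ : mkset _ =
  \bigcap_(i in [set: 'I_n]) ((fun v : 'rV[R]_n => v 0 i : measurableTypeR R) @^-1` A i)); last first.
  by apply/seteqP; split=> v Av i; [move=> _|]; exact: Av.
apply: fin_bigcap_measurable => // i _; rewrite -[X in measurable X]setTI.
have mid : measurable_fun setT (@id 'rV[R]_n) by exact: measurable_id.
exact: (measurable_fun_rVP _).1 mid i measurableT _ (mA i).
Qed.

Lemma lebesgue_rV_box (R : realType) (n : nat) (A : 'I_n -> set R) :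
  (forall i, measurable (A i)) ->
  lebesgue_rV n [set v | forall i, A i (v 0 i)] =
  (\prod_(i < n) lebesgue_measure (A i))%E.
Proof.
elim: n A => [|n IHn] A mA.
  by rewrite big_ord0 /= diracE mem_set//= => -[].
rewrite big_ord_recl -IHn//.
rewrite -product_measure1E; [|exact: mA|by apply: (@measurable_rV_box R n (fun i => A (lift ord0 i)))].
rewrite /= /rV_prod /pushforward; congr (_ _).
apply/seteqP; split=> [p Ap|p [A0 AS] i] /=.
  by split=> [|i]; [have := Ap ord0; rewrite rV_cons0|have := Ap (lift ord0 i); rewrite rV_consS].
by case: (unliftP ord0 i) => [j|] ->; rewrite (rV_cons0,rV_consS).
Qed.

Section convex_extended.
Context {R : realType} {n : nat}.
Implicit Types (u : 'rV[R]_n -> \bar R) (x y : 'rV[R]_n).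

Definition effective_dom u : set 'rV[R]_n := [set x | (u x < +oo)%E].

(* Adequate because it is only used for functions avoiding -oo: no
   indeterminate sum occurs, and 0 * +oo = 0 makes the endpoints trivial. *)
Definition econvex_function u : Prop :=
  forall x y (t : R), 0 <= t <= 1 ->
    (u (t *: x + (1 - t) *: y)%R <= t%:E * u x + (1 - t)%:E * u y)%E.

Definition closed_convex_class (Omega : set 'rV[R]_n) (M : R) :
    set ('rV[R]_n -> \bar R) :=
  [set u | [/\ (forall x, u x != -oo%E) /\ effective_dom u = Omega,
               lower_semicontinuous u,
               econvex_function u,
               ereal_inf (range u) = 0%E &
               forall x, Omega x -> (u x <= M%:E)%E]].

(* Finiteness near x is required because fine maps +oo to 0, so that fine \o u
   alone could be differentiable at a boundary point of the domain. *)
Definition edifferentiable u x : Prop :=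
  (\forall y \near x, u y \is a fin_num) /\ differentiable (fine \o u) x.

(* The differential of u at x in the coordinates of the dual basis, i.e. the
   row of partial derivatives; 0 by convention where u is not differentiable. *)
Definition egradient u x : 'rV[R]_n :=
  if `[< edifferentiable u x >] then
    \row_i 'd (fine \o u) x (delta_mx 0 i : 'rV[R]_n)
  else 0.

End convex_extended.

(* Main.v *)
From HB Require Import structures.
Require Import Defs.
From mathcomp Require Import all_boot all_order all_algebra.
From mathcomp Require Import all_classical all_reals all_analysis.
From mathcomp Require Import measurable_realfun lra ring.
Set Implicit Arguments.
Unset Strict Implicit.
Unset Printing Implicit Defensive.
Import Order.TTheory GRing.Theory Num.Theory.
Import numFieldNormedType.Exports.
Local Open Scope classical_set_scope.
Local Open Scope ring_scope.

(** The theorem is dominated convergence, with a constant as majorant: [f] is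
    bounded and [Omega] has finite measure, so it suffices that for almost every
    [x] in [Omega] the gradients of all the [u_ k] and of [u] exist at [x], that
    they are Borel functions, and that [egradient (u_ k) x] tends to
    [egradient u x].

    Convergence of the gradients ([cvg_diff]). At a common point of
    differentiability, the derivative of a convex function in a direction [e]
    lies between its slopes at parameters [- s] and [s].  For fixed [s] these
    slopes converge with [k], by pointwise convergence, and the slopes of the
    limit function are close to its derivative once [s] is small.

    Differentiability almost everywhere ([ae_differentiable]). A convex
    function [g] has a kink in the direction [e] at [x] if its left and right
    derivatives along [e] differ at [x].  Three facts combine:
    - on a line there are countably many kinks, because between the left and
      the right derivative one finds a rational slope whose supporting line
      touches the graph only at that point ([countable_kinks]);
    - the set of kinks is Borel, and by Fubini a Borel set that meets every line
      parallel to a given axis in a countable set is a null set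
      ([lebesgue_rV_countable_lines]);
    - a convex function without kinks along the coordinate axes at [x] is
      differentiable at [x]: its remainder is bounded above by the mean of the
      remainders along the axes, and a convex function that vanishes at 0 and is
      bounded above by [o(v)] is also bounded below by [- o(v)]
      ([no_kink_differentiable]).

    The boundary of [Omega] ([ae_interior]). Differentiability of [u_ k] makes
    sense in the interior only, so the boundary has to be a null set.  This
    is again almost everywhere differentiability, now for the distance to
    [Omega]: it is convex, vanishes on [Omega], and grows at least linearly along
    a ray from an interior point once the ray has passed a boundary point; hence
    it has a kink at each boundary point of [Omega].

    Measurability ([measurable_comp_egradient]). The points of
    differentiability are the interior points without kinks, and there the
    gradient is the limit of difference quotients at the steps [1 / (m + 1)],
    which are Borel because a lower semicontinuous function is. *)

(** * Slopes of a convex function along a line *)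

Definition convex_on (R : realType) (V : lmodType R) (C : set V) (g : V -> R) :=
  forall x y (t : R), C x -> C y -> 0 <= t <= 1 ->
    g (t *: x + (1 - t) *: y) <= t * g x + (1 - t) * g y.

Definition slope (R : realType) (V : lmodType R) (g : V -> R) (e x : V) (s : R) : R :=
  (g (x + s *: e) - g x) / s.

(** For convex [g] it is nonnegative and decreases, as [s] decreases to 0, to the
    jump of the derivative at [x]. *)
Definition slope_gap (R : realType) (V : lmodType R) (g : V -> R) (e x : V) (s : R) : R :=
  slope g e x s - slope g e x (- s).

(** At a point around which [g] is convex, this says that the one-sided
    derivatives along [e] differ; the steps [1 / (m + 1)] suffice since the gap is monotone in the step, and a
    countable family of steps keeps the set of kinks Borel. *)
Definition kink (R : realType) (V : lmodType R) (g : V -> R) (e x : V) : Prop :=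
  ~ (slope_gap g e x m.+1%:R^-1 @[m --> \oo] --> (0 : R)).

Section slopes.
Context {R : realType} {V : normedModType R}.
Variables (C : set V) (g : V -> R) (e x : V).
Hypotheses (gC : convex_on C g) (Cx : C° x).

Let C_x : C x. Proof. exact: interior_subset Cx. Qed.

Lemma slopeM s : s != 0 -> g (x + s *: e) = g x + slope g e x s * s.
Proof. by move=> s0; rewrite /slope divfK// subrKC. Qed.

(** The three cases of signs are the three ways in which one of the points
    [x], [x + s *: e], [x + s' *: e] is a convex combination of the others. *)
Lemma slope_homo s s' : s != 0 -> s' != 0 -> s < s' ->
  C (x + s *: e) -> C (x + s' *: e) -> slope g e x s <= slope g e x s'.
Proof.
move=> s0 s'0 ss' Cs Cs'.
have conv a b t : 0 <= t <= 1 -> C (x + a *: e) -> C (x + b *: e) ->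
    g (x + (t * a + (1 - t) * b) *: e) <= t * g (x + a *: e) + (1 - t) * g (x + b *: e).
  move=> t01 Ca Cb; apply: le_trans (gC Ca Cb t01); rewrite le_eqVlt; apply/orP; left.
  apply/eqP; congr g; rewrite !scalerDr addrACA -scalerDl (_ : t + (1 - t) = 1) ?scale1r; last by ring.
  by rewrite !scalerA -scalerDl.
have C0 : C (x + 0 *: e) by rewrite scale0r addr0.
have := slopeM s0; have := slopeM s'0.
set A := slope _ _ _ s; set B := slope _ _ _ s' => gs' gs.
case: (ltgtP s 0) s0 => // s_0 _; case: (ltgtP s' 0) s'0 => // s'_0 _.
- have /conv : 0 <= s' / s <= 1.
    have : s' / s * s = s' by rewrite divfK// lt_eqF.
    by move=> ?; apply/andP; split; nra.
  move=> /(_ s 0 Cs C0); rewrite mulr0 addr0 divfK ?lt_eqF// scale0r addr0 gs gs'.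
  rewrite mulrDr (mulrCA _ A) (_ : s' / s * s = s') ?divfK ?lt_eqF//.
  by nra.
- have /conv : 0 <= s' / (s' - s) <= 1.
    have : s' / (s' - s) * (s' - s) = s' by rewrite divfK//; lra.
    by move=> ?; apply/andP; split; nra.
  move=> /(_ s s' Cs Cs'); rewrite (_ : _ * s + _ = 0); last by field; lra.
  rewrite scale0r addr0 gs gs'.
  rewrite [X in _ <= X](_ : _ = g x + (B - A) * (s' * - s / (s' - s))); last by field; lra.
  rewrite lerDl pmulr_lge0 ?subr_ge0// divr_gt0 ?mulr_gt0//; lra.
- lra.
- have /conv : 0 <= s / s' <= 1.
    have : s / s' * s' = s by rewrite divfK// gt_eqF.
    by move=> ?; apply/andP; split; nra.
  move=> /(_ s' 0 Cs' C0); rewrite mulr0 addr0 divfK ?gt_eqF// scale0r addr0 gs gs'.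
  rewrite mulrDr (mulrCA _ B) (_ : s / s' * s' = s) ?divfK ?gt_eqF//.
  by nra.
Qed.

Lemma interior_segment : exists2 d : R, 0 < d &
  forall s, `|s| < d -> C° (x + s *: e).
Proof.
have : nbhs 0 [set s : R | C° (x + s *: e)].
  have : {for (0 : R), continuous (fun s : R => x + s *: e)}.
    by apply: cvgD; [exact: cvg_cst|apply: cvgZr_tmp; exact: cvg_id].
  by apply; rewrite /= scale0r addr0; apply: open_nbhs_nbhs; split => //; exact: open_interior.
move=> /nbhs_ballP[d/= d0 H]; exists d => // s sd; apply: H.
by rewrite /ball/= sub0r normrN.
Qed.

Lemma slope_opp_le s s' : 0 < s -> 0 < s' -> C (x + s *: e) -> C (x + (- s') *: e) ->
  slope g e x (- s') <= slope g e x s.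
Proof. by move=> s0 s'0 Cs Cs'; apply: slope_homo => //; lra. Qed.

Lemma slope_mono s s' : 0 < s -> s <= s' -> C (x + s *: e) -> C (x + s' *: e) ->
  slope g e x s <= slope g e x s'.
Proof.
move=> s0; rewrite le_eqVlt => /orP[/eqP->//|ss' Cs Cs'].
by apply: slope_homo => //; lra.
Qed.

Lemma slope_opp_mono s s' : 0 < s -> s <= s' -> C (x + (- s) *: e) -> C (x + (- s') *: e) ->
  slope g e x (- s') <= slope g e x (- s).
Proof.
move=> s0; rewrite le_eqVlt => /orP[/eqP->//|ss' Cs Cs'].
by apply: slope_homo => //; lra.
Qed.

Lemma slope_gap_ge0 s : 0 < s -> C (x + s *: e) -> C (x + (- s) *: e) ->
  0 <= slope_gap g e x s.
Proof. by move=> s0 Cs Cs'; rewrite subr_ge0 slope_opp_le. Qed.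

Lemma near_invS (d : R) : 0 < d -> \forall m \near \oo, m.+1%:R^-1 < d.
Proof. by move=> d0; exact: near_infty_natSinv_lt (PosNum d0). Qed.

(** If the gap between some right slope and some left slope were below [eps],
    monotonicity would keep all gaps at smaller steps below [eps]. *)
Lemma kink_slopes_apart : kink g e x -> exists2 eps : R, 0 < eps &
  forall s s', 0 < s -> 0 < s' -> C (x + s *: e) -> C (x + (- s') *: e) ->
  slope g e x (- s') + eps <= slope g e x s.
Proof.
apply: contra_notP => /forall2NP H; apply/cvgrPdist_lt => eps eps0.
have [|] := H eps; first by rewrite eps0.
move=> /existsNP[s /existsNP[s' /not_implyP[s0 /not_implyP[s'0]]]].
move=> /not_implyP[Cs /not_implyP[Cs' /negP]]; rewrite -ltNge => ss'.
have [d d0 dC] := interior_segment.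
near=> m.
have rd : m.+1%:R^-1 < d by near: m; exact: near_invS.
have rs : m.+1%:R^-1 < s by near: m; exact: near_invS.
have rs' : m.+1%:R^-1 < s' by near: m; exact: near_invS.
set r := m.+1%:R^-1 in rd rs rs' *; have r0 : 0 < r by rewrite invr_gt0.
have Cr : C (x + r *: e) by apply: interior_subset; apply: dC; rewrite gtr0_norm.
have Cr' : C (x + (- r) *: e) by apply: interior_subset; apply: dC; rewrite normrN gtr0_norm.
have h0 := slope_gap_ge0 r0 Cr Cr'.
rewrite sub0r normrN ger0_norm//.
have := slope_mono r0 (ltW rs) Cr Cs.
have := slope_opp_mono r0 (ltW rs') Cr' Cs'.
by rewrite /slope_gap; lra.
Unshelve. all: by end_near. Qed.

Definition right_slopes := [set slope g e x s | s in [set s | 0 < s /\ C (x + s *: e)]].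

Lemma right_slopes_ne : right_slopes !=set0.
Proof.
have [d d0 dC] := interior_segment.
exists (slope g e x (d / 2)); exists (d / 2) => //; split; first lra.
by apply: interior_subset; apply: dC; rewrite gtr0_norm; lra.
Qed.

Lemma slope_opp_le_inf s eps : 0 < s -> C (x + (- s) *: e) ->
  (forall s', 0 < s' -> C (x + s' *: e) -> slope g e x (- s) + eps <= slope g e x s') ->
  slope g e x (- s) + eps <= inf right_slopes.
Proof.
move=> s0 Cs H; apply: lb_le_inf; first exact: right_slopes_ne.
by move=> _ [s' [s'0 Cs'] <-]; exact: H.
Qed.

Lemma inf_le_slope s : 0 < s -> C (x + s *: e) -> inf right_slopes <= slope g e x s.
Proof.
move=> s0 Cs; apply: ge_inf; last by exists s.
have [d d0 dC] := interior_segment.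
exists (slope g e x (- (d / 2))) => _ [s' [s'0 Cs'] <-]; apply: slope_opp_le => //; first lra.
by apply: interior_subset; apply: dC; rewrite normrN gtr0_norm; lra.
Qed.

(** The rational [q] is chosen strictly between the one-sided derivatives; the
    strict inequality is what makes [q] determine the point [x] on its line. *)
Lemma kink_rat_subgradient : kink g e x -> exists q : rat, forall s, s != 0 -> C (x + s *: e) ->
  g x + ratr q * s < g (x + s *: e).
Proof.
move=> /kink_slopes_apart[eps eps0 gap]; set p := inf right_slopes.
have /rat_in_itvoo[q] : p - eps < p by lra.
rewrite in_itv/= => /andP[q1 q2]; exists q => s s0 Cs; rewrite slopeM// ltrD2l.
case: (ltgtP s 0) s0 => // s0 _.
  rewrite ltr_nM2r//; apply: le_lt_trans q1.
  have := @slope_opp_le_inf (- s) eps; rewrite opprK oppr_gt0 => /(_ s0 Cs) H.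
  rewrite -/p in H; suff : slope g e x s + eps <= p by lra.
  by apply: H => s' s'0 Cs'; have := @gap s' (- s); rewrite opprK oppr_gt0; exact.
by rewrite ltr_pM2r//; apply: lt_le_trans q2 _; exact: inf_le_slope.
Qed.

(** The slope [p] is the right derivative, as an infimum of slopes.  The bound
    holds for both signs of [s]: left and right slopes at a distance up to [d]
    enclose [p] and differ by at most [eps]. *)
Lemma no_kink_partial : ~ kink g e x -> exists p, forall eps : R, 0 < eps ->
  exists2 d : R, 0 < d & forall s, `|s| < d -> C (x + s *: e) /\
    0 <= g (x + s *: e) - g x - p * s <= eps * `|s|.
Proof.
move=> /contrapT/cvgrPdist_lt nk; exists (inf right_slopes); set p := inf _ => eps eps0.
have [d d0 dC] := interior_segment.
have {nk} [m [md]] : exists m : nat, (m.+1%:R^-1 < d /\ `|0 - slope_gap g e x m.+1%:R^-1| < eps).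
  near \oo => m; exists m; split; last by near: m; exact: nk.
  by near: m; exact: near_invS.
set r := m.+1%:R^-1 in md *; have r0 : 0 < r by rewrite invr_gt0.
have Cd s : `|s| < d -> C (x + s *: e) by move=> /dC/interior_subset.
have Cr : C (x + r *: e) by apply: Cd; rewrite gtr0_norm.
have Cr' : C (x + (- r) *: e) by apply: Cd; rewrite normrN gtr0_norm.
rewrite sub0r normrN ger0_norm ?slope_gap_ge0// /slope_gap => hr.
exists r => // s sr; have Cs : C (x + s *: e) by apply: Cd; exact: lt_trans md.
split => //; have leps s' : 0 < s' -> C (x + (- s') *: e) -> slope g e x (- s') <= p.
  move=> s'0 Cs'; have := @slope_opp_le_inf s' 0; rewrite addr0; apply => //.
  by move=> t t0 Ct; exact: slope_opp_le.
have ples s' : 0 < s' -> C (x + s' *: e) -> p <= slope g e x s' by exact: inf_le_slope.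
have pr := ples _ r0 Cr; have rp := leps _ r0 Cr'.
move: p leps ples pr rp => p leps ples pr rp.
case: (ltgtP s 0) => s0.
- rewrite slopeM ?lt_eqF// (addrC (g x)) addrK.
  rewrite ltr0_norm// in sr *.
  have := @slope_opp_mono (- s) r; rewrite !opprK oppr_gt0 => /(_ s0 (ltW sr) Cs Cr').
  have := leps (- s); rewrite opprK oppr_gt0 => /(_ s0 Cs) sp rs.
  have ps : p - slope g e x s <= eps by lra.
  by apply/andP; split; nra.
- rewrite slopeM ?gt_eqF// (addrC (g x)) addrK.
  rewrite gtr0_norm// in sr *.
  have := slope_mono s0 (ltW sr) Cs Cr.
  have := ples _ s0 Cs => ps sr'.
  have sp : slope g e x s - p <= eps by lra.
  by apply/andP; split; nra.
- by rewrite s0 scale0r addr0 normr0 !mulr0 subrr subr0 lexx.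
Unshelve. all: by end_near. Qed.

End slopes.

(** A rational [q] serves at most one point of the line: if the lines of slope
    [q] through two points of the graph both supported it strictly, each of the
    two points would lie strictly above the other line. *)
Lemma countable_kinks (R : realType) (V : normedModType R) (C : set V) (g : V -> R)
    (e x : V) : convex_on C g ->
  countable [set t : R | C° (x + t *: e) /\ kink g e (x + t *: e)].
Proof.
move=> gC.
pose K (q : rat) := [set t : R | C (x + t *: e) /\ forall s, s != 0 ->
  C (x + t *: e + s *: e) -> g (x + t *: e) + ratr q * s < g (x + t *: e + s *: e)].
apply: (@sub_countable _ _ _ (\bigcup_(q in [set: rat]) K q)).
  apply/subset_card_le => t [/= Ct /(kink_rat_subgradient gC Ct)[q qP]].
  by exists q => //; split => //; exact: interior_subset.
apply: bigcup_countable => // q _; apply/finite_set_countable.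
have K1 t t' : K q t -> K q t' -> t = t'.
  move=> [Ct tP] [Ct' t'P]; apply/eqP/negPn/negP => tt'.
  have xtt' : x + t *: e + (t' - t) *: e = x + t' *: e by rewrite -addrA -scalerDl subrKC.
  have xt't : x + t' *: e + (t - t') *: e = x + t *: e by rewrite -addrA -scalerDl subrKC.
  have := tP (t' - t); rewrite xtt' subr_eq0 eq_sym => /(_ tt' Ct').
  have := t'P (t - t'); rewrite xt't subr_eq0 => /(_ tt' Ct).
  by lra.
have [->|/set0P[t Kt]] := eqVneq (K q) set0; first exact: finite_set0.
by apply: (@sub_finite_set _ _ [set t]) => // t' Kt'; exact/esym/K1.
Qed.

(** * Differentiability of convex functions without kinks along the axes *)

Lemma convex_setP (R : realType) (V : lmodType R) (C : set V) :
  convex_set C <->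
  forall x y (t : R), C x -> C y -> 0 <= t <= 1 -> C (t *: x + (1 - t) *: y).
Proof.
split=> [cC x y t Cx Cy /andP[t0 t1]|cC x y t].
  by have := cC x y (Itv01 t0 t1); rewrite !inE; exact.
by rewrite !inE => Cx Cy; apply: cC => //; rewrite ge0 le1.
Qed.

Lemma convex_ball (R : realType) (V : normedModType R) (x : V) (r : R) :
  convex_set (ball x r).
Proof.
apply/convex_setP => y z t; rewrite -!ball_normE /= => xy xz /andP[t0 t1].
have -> : x - (t *: y + (1 - t) *: z) = t *: (x - y) + (1 - t) *: (x - z).
  rewrite !scalerBr addrACA -scalerDl subrKC scale1r opprD//.
apply: le_lt_trans (ler_normD _ _) _.
rewrite !normrZ (ger0_norm t0) (@ger0_norm _ (1 - t)) ?subr_ge0//.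
have [->|tn0] := eqVneq t 0; first by rewrite mul0r add0r subr0 mul1r.
have {tn0}t0 : 0 < t by rewrite lt_neqAle eq_sym tn0.
apply: (@lt_le_trans _ _ (t * r + (1 - t) * `|x - z|)).
  by rewrite ltrD2r ltr_pM2l.
by move: xz => /ltW; nra.
Qed.

(** Jensen's inequality with equal weights, by adding one point with weight
    [1 / (k + 1)] to the mean of [k] points. *)
Lemma convex_on_mean (R : realType) (V : lmodType R) (C : set V) (g : V -> R)
    (I : eqType) (r : seq I) (v : I -> V) :
  convex_on C g -> convex_set C -> (0 < size r)%N -> (forall i, C (v i)) ->
  C ((size r)%:R^-1 *: \sum_(i <- r) v i) /\
  g ((size r)%:R^-1 *: \sum_(i <- r) v i) <= (size r)%:R^-1 * \sum_(i <- r) g (v i).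
Proof.
move=> gC /convex_setP cC; elim: r => // i r IH _ Cv.
case: (posnP (size r)) => [/size0nil ->|r0].
  by rewrite /= invr1 !big_seq1 scale1r mul1r.
have {IH}[Cr gr] := IH r0 Cv; rewrite !big_cons [size _]/=.
set k := size r in Cr gr r0 *; set t : R := k.+1%:R^-1.
have k0 : 0 < k%:R :> R by rewrite ltr0n.
have tE : t = (k%:R + 1)^-1 by rewrite /t -natr1.
have t01 : 0 <= t <= 1 by rewrite invr_ge0 ler0n invf_le1 ?ler1n ?ltr0n.
have kt : (1 - t) * k%:R^-1 = t by rewrite tE; field; lra.
rewrite (_ : t *: _ = t *: v i + (1 - t) *: (k%:R^-1 *: \sum_(j <- r) v j)); last first.
  by rewrite scalerDr scalerA kt.
split; first exact: cC.
apply: le_trans (gC _ _ _ (Cv i) Cr t01) _; rewrite mulrDr lerD2l.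
rewrite -[in leRHS]kt -mulrA ler_wpM2l//; lra.
Qed.

Definition dotr (R : realType) (n : nat) (p v : 'rV[R]_n) : R := \sum_i p 0 i * v 0 i.

Section dotr.
Context {R : realType} {n : nat} (p : 'rV[R]_n).

Fact dotr_is_linear : linear (dotr p : 'rV[R]_n -> R^o).
Proof.
move=> a v w; rewrite /dotr scaler_sumr -big_split/=; apply: eq_bigr => i _.
by rewrite !mxE mulrDr mulrCA.
Qed.

HB.instance Definition _ :=
  GRing.isLinear.Build R 'rV[R]_n R^o *:%R (dotr p : 'rV[R]_n -> R^o) dotr_is_linear.

Lemma continuous_dotr : continuous (dotr p).
Proof.
apply: (@continuous_big R 'I_n +%R 0 xpredT (@add_continuous R^o) 'rV[R]_n) => i _ v.
apply: (@continuousM R 'rV[R]_n (cst (p 0 i)) (fun v : 'rV[R]_n => v 0 i)).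
  exact: cst_continuous.
exact: coord_continuous.
Qed.

End dotr.

(** Differentiability is defined through a chosen differential, so a candidate
    [df] has to be identified with the chosen one. *)
Lemma differentiable_littleo (R : realType) (V W : normedModType R) (f : V -> W)
    (df : {linear V -> W}) (x : V) : continuous df ->
  (forall eps : R, 0 < eps ->
    \forall v \near (0 : V), `|f (v + x) - (f x + df v)| <= eps * `|v|) ->
  differentiable f x.
Proof.
move=> cdf H; have fdf : f \o shift x = cst (f x) + df +o_ 0 id.
  by apply/eqaddoP => eps eps0; exact: H.
have dE := diff_unique cdf fdf.
by apply/diff_locallyP; rewrite dE; split.
Qed.

Lemma normr_coord_le (R : realType) (n : nat) (v : 'rV[R]_n) i : `|v 0 i| <= `|v|.
Proof. by rewrite [leRHS]mx_normrE; exact: (le_bigmax _ (fun ij => `|v ij.1 ij.2|) (0, i)). Qed.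

Lemma norm_delta_le1 (R : realType) (n : nat) i : `|delta_mx 0 i : 'rV[R]_n| <= 1.
Proof.
rewrite [leLHS]mx_normrE; apply: bigmax_le => // -[a b] _ /=.
by rewrite mxE; case: (_ && _); rewrite ?normr1 ?normr0.
Qed.

(** With [G v := g (x + v) - g x - p . v], the point [x + v] is the mean of the
    [n] points [x + n v_i e_i], so [G v] is at most the mean of the
    [G (n v_i e_i)], each of which is [o(v)].  The lower bound follows from
    [0 <= G v + G (- v)]. *)
Lemma no_kink_differentiable (R : realType) (n : nat) (C : set 'rV[R]_n)
    (g : 'rV[R]_n -> R) (x : 'rV[R]_n) :
  convex_on C g -> C° x -> (forall i, ~ kink g (delta_mx 0 i) x) -> differentiable g x.
Proof.
move=> gC Cx nk.
have /choice[p0 pP] : forall i : 'I_n, exists p : R, forall eps : R, 0 < eps ->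
  \forall s \near (0 : R), `|g (x + s *: delta_mx 0 i) - g x - p * s| <= eps * `|s|.
  move=> i; have [p pP] := no_kink_partial gC Cx (nk i); exists p => eps /pP[d d0 dP].
  apply/nbhs_ballP; exists d => // s; rewrite /ball/= sub0r normrN => /dP[_ /andP[a0 ab]].
  by rewrite ger0_norm.
pose p := \row_i p0 i.
apply: (@differentiable_littleo _ _ _ g (dotr p)); first exact: continuous_dotr.
move=> eps eps0.
(* In dimension 0 there is no mean of n points to take. *)
case: n => [|n] in C g x gC Cx nk p0 pP p *.
  near=> v; rewrite (_ : v = 0) ?add0r ?linear0 ?addr0 ?subrr ?normr0 ?mulr0//.
  by apply/rowP => -[].
pose N : R := n.+1%:R; have N0 : 0 < N by rewrite ltr0n.
pose G v := g (x + v) - g x - dotr p v.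
suff H : \forall v \near (0 : 'rV[R]_n.+1), G v <= eps * `|v| /\ 0 <= G v + G (- v).
  have HN : \forall v \near (0 : 'rV[R]_n.+1), G (- v) <= eps * `|v| /\ 0 <= G v + G (- v).
    have : {for 0, continuous (fun v : 'rV[R]_n.+1 => - v)} by exact: opp_continuous.
    rewrite /prop_for/continuous_at oppr0 => /(_ _ H); rewrite !near_simpl.
    by apply: filterS => v [] /=; rewrite opprK normrN addrC.
  near=> v; have [h1 h2] : G v <= eps * `|v| /\ 0 <= G v + G (- v) by near: v; exact: H.
  have [h3 h4] : G (- v) <= eps * `|v| /\ 0 <= G v + G (- v) by near: v; exact: HN.
  rewrite (addrC v) opprD addrA -/(G v) ler_norml; apply/andP; split => //; lra.
have [d d0 dC] : exists2 d : R, 0 < d & ball x d `<=` C by apply/nbhs_ballP.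
have eN0 : 0 < eps / N by rewrite divr_gt0.
have : \forall s \near (0 : R), forall i : 'I_n.+1,
    `|g (x + s *: delta_mx 0 i) - g x - p0 i * s| <= eps / N * `|s|.
  apply: (@filter_forall _ _ _ _ (@nbhs_filter R 0)) => i; exact: pP.
move=> /nbhs_ballP[r /= r0 rP].
have rd0 : 0 < Num.min (r / N) (d / N) by rewrite lt_min !divr_gt0.
apply/nbhs_ballP; exists (Num.min (r / N) (d / N)) => // v.
rewrite -ball_normE/= sub0r normrN lt_min !ltr_pdivlMr// => /andP[vr vd].
have v_ i : `|N * v 0 i| <= `|v| * N.
  by rewrite normrM gtr0_norm// mulrC ler_pM2r// normr_coord_le.
have Bv i : ball x d (x + (N * v 0 i) *: delta_mx 0 i).
  rewrite -ball_normE/= opprD addNKr normrN; apply: le_lt_trans vd.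
  rewrite normrZ; apply: le_trans (v_ i).
  by rewrite ler_piMr// norm_delta_le1.
have vd' : `|v| < d by apply: le_lt_trans vd; rewrite ler_peMr// ler1n.
have B1 : ball x d (x + v) by rewrite -ball_normE/= opprD addNKr normrN.
have B2 : ball x d (x - v) by rewrite -ball_normE/= opprB addrCA subrr addr0.
have gB : convex_on (ball x d) g by move=> y z t /dC Cy /dC Cz; exact: gC.
split; last first.
  rewrite /G; have := gB _ _ 2^-1 B1 B2; rewrite (_ : _ *: _ + _ = x); last first.
    rewrite (_ : 1 - 2^-1 = 2^-1); last by lra.
    rewrite -scalerDr addrACA subrr addr0 -mulr2n -(scaler_nat 2 x) scalerA mulVf ?scale1r//.
  rewrite linearN => gm; suff : g x <= 2^-1 * g (x + v) + (1 - 2^-1) * g (x - v) by lra.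
  by apply: gm; lra.
have sE : size (enum 'I_n.+1) = n.+1 by rewrite size_enum_ord.
have := @convex_on_mean R _ (ball x d) g _ (enum 'I_n.+1)
   (fun i => x + (N * v 0 i) *: delta_mx 0 i) gB (@convex_ball _ _ _ _).
rewrite sE => /(_ isT Bv)[_]; rewrite !big_enum/= big_split/= scalerDr.
rewrite [X in X + _](_ : _ = x); last first.
  by rewrite sumr_const card_ord -[X in _ *: X](scaler_nat (R := R) n.+1 x) scalerA mulVf ?scale1r// pnatr_eq0.
rewrite [X in x + X](_ : _ = v); last first.
  rewrite scaler_sumr [RHS]row_sum_delta; apply: eq_bigr => i _.
  by rewrite scalerA mulKf// gt_eqF.
move=> gv; rewrite /G lerBlDr lerBlDr; apply: le_trans gv _.
rewrite ler_pdivrMl//.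
apply: (@le_trans _ _ (\sum_(i < n.+1) (g x + p0 i * (N * v 0 i) + eps / N * (`|v| * N)))).
  apply: ler_sum => i _.
  have : `|0 - N * v 0 i| < r by rewrite sub0r normrN (le_lt_trans (v_ i)).
  move=> /rP/(_ i); rewrite ler_norml => /andP[_].
  have : eps / N * `|N * v 0 i| <= eps / N * (`|v| * N) by rewrite ler_pM2l.
  by move=> h1 h2; rewrite -lerBlDl opprD addrA; exact: le_trans h2 h1.
have sumc c : \sum_(i < n.+1) c = N * c by rewrite sumr_const card_ord mulr_natl.
rewrite !big_split/= !sumc (_ : \sum_(i < n.+1) _ = N * dotr p v); last first.
  by rewrite /dotr mulr_sumr; apply: eq_bigr => i _; rewrite mxE mulrCA.
have -> : eps / N * (`|v| * N) = eps * `|v| by rewrite mulrCA divfK ?gt_eqF// mulrC.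
by rewrite -!mulrDr ler_pM2l// [leLHS]addrC (addrC (g x)) addrA.
Unshelve. all: by end_near. Qed.

(** * Differentials as limits of slopes *)

Section differential_slopes.
Context {R : realType} {V : normedModType R}.
Implicit Types (C : set V) (g : V -> R) (e x : V).

Lemma cvg_slope g e x : differentiable g x ->
  slope g e x s @[s --> (0 : R)^'] --> ('d g x e : R).
Proof.
move=> gx; have gl : h^-1 *: ((g \o shift x) (h *: e) - g x) @[h --> (0 : R)^'] --> 'D_e g x.
  exact: (@diff_derivable _ _ _ g x e gx).
rewrite -deriveE// (_ : (fun s : R => _) = fun h => h^-1 *: ((g \o shift x) (h *: e) - g x))//.
by apply/funext => s; rewrite /slope/= (addrC x); exact: mulrC.
Qed.

Lemma cvg_invS_dnbhs : m.+1%:R^-1 @[m --> \oo] --> (0 : R)^'.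
Proof.
move=> A [r /= r0 rA]; rewrite !near_simpl; near=> m.
have mr : m.+1%:R^-1 < r by near: m; exact: near_invS r0.
apply: rA => /=; first by rewrite sub0r normrN gtr0_norm ?invr_gt0.
by rewrite gt_eqF// invr_gt0.
Unshelve. all: by end_near. Qed.

Lemma cvg_slope_invS g e x : differentiable g x ->
  slope g e x m.+1%:R^-1 @[m --> \oo] --> ('d g x e : R).
Proof. by move=> /(cvg_slope (e := e)); exact: cvg_comp cvg_invS_dnbhs. Qed.

Lemma slopeN g e x s : slope g (- e) x s = - slope g e x (- s).
Proof. by rewrite /slope scalerN -scaleNr invrN mulrN opprK. Qed.

Lemma cvg_slope_invSN g e x : differentiable g x ->
  slope g e x (- m.+1%:R^-1) @[m --> \oo] --> ('d g x e : R).
Proof.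
move=> /(cvg_slope_invS (e := - e)); rewrite linearN => /cvgN; rewrite opprK.
rewrite (_ : (fun m => slope g e x _) = fun m => - slope g (- e) x m.+1%:R^-1)//.
by apply/funext => m; rewrite slopeN opprK.
Qed.

Lemma differentiable_no_kink g e x : differentiable g x -> ~ kink g e x.
Proof.
move=> gx; apply; rewrite -[X in _ --> X](subrr ('d g x e : R)).
by apply: cvgB; [exact: cvg_slope_invS|exact: cvg_slope_invSN].
Qed.

(** The slopes decrease to the derivative as the step decreases to 0. *)
Lemma diff_le_slope C g e x s : convex_on C g -> C° x -> differentiable g x ->
  0 < s -> C (x + s *: e) -> 'd g x e <= slope g e x s.
Proof.
move=> gC Cx gx s0 Cs.
have [d d0 dC] := interior_segment e Cx.
apply: (ler_cvg_to (cvg_slope_invS (e := e) gx) (cvg_cst (slope g e x s))).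
near=> m; have md : m.+1%:R^-1 < d by near: m; exact: near_invS.
apply: (slope_mono gC Cx) => //; first by near: m; apply: filterS (near_invS s0) => k /ltW.
by apply: interior_subset; apply: dC; rewrite gtr0_norm// invr_gt0.
Unshelve. all: by end_near. Qed.

Lemma diff_ge_slope C g e x s : convex_on C g -> C° x -> differentiable g x ->
  0 < s -> C (x - s *: e) -> slope g e x (- s) <= 'd g x e.
Proof.
move=> gC Cx gx s0 Cs.
have := @diff_le_slope C g (- e) x s gC Cx gx s0.
by rewrite scalerN slopeN linearN lerNl opprK; exact.
Qed.

Let error_lower (p a b c eps : R) :
  p <= b -> b - eps / 2 < a -> a - eps / 2 < c -> - eps < c - p.
Proof. by lra. Qed.

Let error_upper (p a b c eps : R) :
  b <= p -> a - eps / 2 < b -> c - eps / 2 < a -> c - p < eps.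
Proof. by lra. Qed.

(** The error [eps] is split into one half for the distance between the
    derivative of [g] and its slopes at a step [s], chosen first, and one half for
    the distance between the slopes of [g_ k] and those of [g] at this step. *)
Lemma cvg_diff C (g_ : nat -> V -> R) g e x :
  (forall k, convex_on C (g_ k)) -> C° x ->
  (forall k, differentiable (g_ k) x) -> differentiable g x ->
  (forall y, C° y -> g_ k y @[k --> \oo] --> g y) ->
  ('d (g_ k) x e : R) @[k --> \oo] --> ('d g x e : R).
Proof.
move=> gC Cx g_x gx g_g; apply/cvgrPdist_lt => eps eps0.
have [d d0 dC] := interior_segment e Cx.
have e20 : 0 < eps / 2 by rewrite divr_gt0.
have [m [md [m1 m2]]] : exists m, m.+1%:R^-1 < d /\
    (`|'d g x e - slope g e x m.+1%:R^-1| < eps / 2 /\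
     `|'d g x e - slope g e x (- m.+1%:R^-1)| < eps / 2).
  near \oo => m; exists m; split; first by near: m; exact: near_invS.
  split; near: m.
    by have /cvgrPdist_lt := cvg_slope_invS (e := e) gx; exact.
  by have /cvgrPdist_lt := cvg_slope_invSN (e := e) gx; exact.
set s : R := m.+1%:R^-1 in md m1 m2; have s0 : 0 < s by rewrite invr_gt0.
have C1 : C° (x + s *: e) by apply: dC; rewrite gtr0_norm.
have C2 : C° (x + (- s) *: e) by apply: dC; rewrite normrN gtr0_norm.
have cvs t : C° (x + t *: e) -> slope (g_ k) e x t @[k --> \oo] --> slope g e x t.
  by move=> Ct; apply: cvgMr_tmp; apply: cvgB; exact: g_g.
near=> k.
have up := diff_le_slope (gC k) Cx (g_x k) s0 (interior_subset C1).
have lo := @diff_ge_slope C (g_ k) e x s (gC k) Cx (g_x k) s0.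
rewrite -scaleNr in lo; have {}lo := lo (interior_subset C2).
have /ltr_distlCBl s1 : `|slope g e x s - slope (g_ k) e x s| < eps / 2.
  by near: k; have /cvgrPdist_lt := cvs _ C1; exact.
have /ltr_distlBl s2 : `|slope g e x (- s) - slope (g_ k) e x (- s)| < eps / 2.
  by near: k; have /cvgrPdist_lt := cvs _ C2; exact.
have {}m1 := ltr_distlCBl m1; have {}m2 := ltr_distlBl m2.
rewrite ltr_norml; apply/andP; split.
  by move: up s1 m1; exact: error_lower.
by move: lo s2 m2; exact: error_upper.
Unshelve. all: by end_near. Qed.

End differential_slopes.

(** * Borel sets with countable sections are null *)

Lemma rV_cons_line0 (R : realType) (n : nat) (t : R) (v : 'rV[R]_n) :
  rV_cons (t, v) = rV_cons (0, v) + t *: delta_mx 0 ord0.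
Proof.
apply/rowP => i; rewrite [RHS]mxE [X in _ = _ + X]mxE [X in _ = _ + _ * X]mxE eqxx/=.
case: (unliftP ord0 i) => [j|] ->; first by rewrite !rV_consS eq_sym (negbTE (neq_lift _ _)) mulr0 addr0.
by rewrite !rV_cons0 eqxx mulr1 add0r.
Qed.

Lemma rV_cons_lineS (R : realType) (n : nat) (t s : R) (v : 'rV[R]_n) (j : 'I_n) :
  rV_cons (t, v + s *: delta_mx 0 j) = rV_cons (t, v) + s *: delta_mx 0 (lift ord0 j).
Proof.
apply/rowP => i; rewrite [RHS]mxE [X in _ = _ + X]mxE [X in _ = _ + _ * X]mxE eqxx/=.
case: (unliftP ord0 i) => [k|] ->; last by rewrite !rV_cons0 (negbTE (neq_lift _ _)) mulr0 addr0.
by rewrite !rV_consS !mxE eqxx/= (inj_eq lift_inj).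
Qed.

(** The induction follows the recursive product: for the first axis the lines are
    the sections of the second projection, so the two product measures are
    exchanged; for any other axis the lines stay within the slices of the first
    projection, to which the induction hypothesis applies. *)
Lemma lebesgue_rV_countable_lines (R : realType) (n : nat) (N : set 'rV[R]_n) (i : 'I_n) :
  measurable N -> (forall x, countable [set t : R | N (x + t *: delta_mx 0 i)]) ->
  lebesgue_rV n N = 0.
Proof.
elim: n => [|n IH] in N i *; first by case: i.
move=> mN cN; rewrite /= /rV_prod /pushforward.
set A := _ @^-1` N; have mA : measurable A.
  by rewrite -[A]setTI; exact: measurable_rV_cons.
case: (unliftP ord0 i) => [j|] iE.
  rewrite /product_measure1 /= integral0_eq// => t _ /=.
  apply: (IH _ j); first exact: measurable_xsection.
  move=> x; apply: (@sub_countable _ _ _ _ _ (cN (rV_cons (t, x)))).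
  by apply/subset_card_le => s; rewrite /= xsectionE /= /A /= rV_cons_lineS iE.
rewrite (@product_measure_unique _ _ _ _ _ _ _ (lebesgue_measure \x^ lebesgue_rV n)%E)//; last first.
  by move=> B C mB mC; exact: product_measure2E.
rewrite /= /product_measure2 integral0_eq// => v _ /=.
apply: countable_lebesgue_measure0; apply: (@sub_countable _ _ _ _ _ (cN (rV_cons (0, v)))).
by apply/subset_card_le => s; rewrite /= ysectionE /= /A /= (rV_cons_line0 s) iE.
Qed.

(** * Almost everywhere differentiability of convex functions *)

Lemma measurable_cvg0 d (T : measurableType d) (R : realType) (h : nat -> T -> R) :
  (forall m, measurable_fun setT (h m)) ->
  measurable [set x | h m x @[m --> \oo] --> (0 : R)].
Proof.
move=> mh; rewrite (_ : mkset _ = \bigcap_k \bigcup_N \bigcap_(m in [set m | (N <= m)%N])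
    (h m @^-1` ball (0 : R) k.+1%:R^-1)).
  apply: bigcapT_measurable => k; apply: bigcupT_measurable => N.
  apply: bigcap_measurable; first by exists N => /=.
  move=> m _; rewrite -[X in measurable X]setTI; apply: mh => //.
  by apply: open_measurable; exact: ball_open.
apply/seteqP; split => [x /= /cvgrPdist_lt hx k _|x hx].
  have /hx[N _ HN] : 0 < k.+1%:R^-1 :> R by rewrite invr_gt0.
  by exists N => // m /HN.
apply/cvgrPdist_lt => eps eps0.
have [k ke] : exists k : nat, k.+1%:R^-1 < eps.
  by near \oo => k; exists k; near: k; exact: near_invS.
have [N _ HN] := hx k I; exists N => // m /= Nm.
by apply: lt_trans ke; exact: HN.
Unshelve. all: by end_near. Qed.

Lemma continuous_measurable_rV (R : realType) (n : nat) (f : 'rV[R]_n -> R) :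
  continuous f -> measurable_fun setT f.
Proof.
move=> /continuousP cf; apply: (measurability _ (RGenOpens.measurableE R)).
move=> _ [_ [a [b ->] <-]]; rewrite setTI; apply: open_measurable_rV.
exact/cf/interval_open.
Qed.

Section kinks_null.
Context {R : realType} {n : nat}.
Implicit Types (C : set 'rV[R]_n) (g : 'rV[R]_n -> R).

Lemma measurable_slope g e s : measurable_fun setT g ->
  measurable_fun setT (fun x => slope g e x s).
Proof.
move=> mg; apply: measurable_funM => //; apply: measurable_funB => //.
apply: (measurableT_comp mg); apply/measurable_fun_rVP => i.
apply: (eq_measurable_fun (fun x : 'rV[R]_n => x 0 i + (s *: e) 0 i)) => [x _|]; first by rewrite [RHS]mxE.
apply: measurable_funD => //.
have mid : measurable_fun setT (@id 'rV[R]_n) by exact: measurable_id.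
exact: (measurable_fun_rVP _).1 mid i.
Qed.

Lemma measurable_kink g e : measurable_fun setT g -> measurable [set x | kink g e x].
Proof.
move=> mg; apply: measurableC; apply: measurable_cvg0 => m.
by apply: measurable_funB; exact: measurable_slope.
Qed.

Lemma ae_no_kink C g (i : 'I_n) : measurable_fun setT g -> convex_on C g ->
  {ae lebesgue_rV n, forall x, C° x -> ~ kink g (delta_mx 0 i) x}.
Proof.
move=> mg gC; exists (C° `&` [set x | kink g (delta_mx 0 i) x]); split.
- apply: measurableI; last exact: measurable_kink.
  by apply: open_measurable_rV; exact: open_interior.
- apply: (@lebesgue_rV_countable_lines _ _ _ i).
    apply: measurableI; last exact: measurable_kink.
    by apply: open_measurable_rV; exact: open_interior.
  by move=> x; exact: countable_kinks.
- by move=> x /= /not_implyP[Cx /contrapT].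
Qed.

Theorem ae_differentiable C g : measurable_fun setT g -> convex_on C g ->
  {ae lebesgue_rV n, forall x, C° x -> differentiable g x}.
Proof.
move=> mg gC; have : {ae lebesgue_rV n, forall x, forall i : 'I_n, C° x -> ~ kink g (delta_mx 0 i) x}.
  by apply: filter_forall => i; exact: ae_no_kink.
apply: filterS => x nk Cx; apply: (no_kink_differentiable gC Cx) => i.
exact: nk.
Qed.

End kinks_null.

(** * The boundary of a convex set is null *)

Section dist_to.
Context {R : realType} {V : normedModType R}.
Implicit Types (O : set V) (x y : V).

Definition dist_to O x : R := inf [set `|x - y| | y in O].

Lemma dist_to_le O x y : O y -> dist_to O x <= `|x - y|.
Proof. by move=> Oy; apply: ge_inf; [exists 0 => _ [z _ <-]|exists y]. Qed.

Lemma le_dist_to O x r : O !=set0 -> (forall y, O y -> r <= `|x - y|) -> r <= dist_to O x.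
Proof.
move=> [y0 Oy0] H; apply: lb_le_inf; first by exists `|x - y0|; exists y0.
by move=> _ [y Oy <-]; exact: H.
Qed.

Lemma dist_to_adherent O x eps : O !=set0 -> 0 < eps ->
  exists2 y, O y & `|x - y| < dist_to O x + eps.
Proof.
move=> [y0 Oy0] eps0; have [|_ [y Oy <-] xy] := @inf_adherent _ [set `|x - y| | y in O] _ eps0.
  by split; [exists `|x - y0|; exists y0|exists 0 => _ [z _ <-]].
by exists y.
Qed.

Lemma continuous_dist_to O : O !=set0 -> continuous (dist_to O).
Proof.
move=> O0 x; have dD a b : dist_to O a - `|a - b| <= dist_to O b.
  apply: le_dist_to => // y /(dist_to_le a) ay; rewrite lerBlDr; apply: le_trans ay _.
  by rewrite [leRHS]addrC; exact: ler_distD.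
apply/cvgrPdist_lt => eps eps0; near=> y.
have xy : `|x - y| < eps by near: y; apply/nbhs_ballP; exists eps => // y; rewrite -ball_normE.
have := dD x y; have := dD y x; rewrite (distrC y) => h1 h2.
by rewrite ltr_norml; apply/andP; split; clear - h1 h2 xy; lra.
Unshelve. all: by end_near. Qed.

Lemma convex_dist_to O : O !=set0 -> convex_set O -> convex_on setT (dist_to O).
Proof.
move=> O0 /convex_setP cO x y t _ _ t01; apply/ler_addgt0Pr => eps eps0.
have [a Oa xa] := dist_to_adherent x O0 eps0.
have [b Ob yb] := dist_to_adherent y O0 eps0.
apply: (le_trans (dist_to_le _ (cO a b t Oa Ob t01))).
rewrite opprD addrACA -!scalerBr; apply: le_trans (ler_normD _ _) _.
case/andP: t01 => t0 t1; rewrite !normrZ (ger0_norm t0) (@ger0_norm _ (1 - t)) ?subr_ge0//.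
apply: (@le_trans _ _ (t * (dist_to O x + eps) + (1 - t) * (dist_to O y + eps))).
  by apply: lerD; rewrite ler_wpM2l ?subr_ge0// ltW.
by rewrite le_eqVlt; apply/orP; left; apply/eqP; ring.
Qed.

End dist_to.

Section boundary.
Context {R : realType} {n : nat}.
Implicit Types (O : set 'rV[R]_n) (x y : 'rV[R]_n).

(** Otherwise some [y] in [O] is closer than [r * s] to the point
    [x + s *: (x - c)], and every [z] near [x] is a convex combination of [y] and
    of a point [b] of the ball around [c], which would make [x] interior. *)
Lemma dist_to_ge_boundary O x c r s : convex_set O -> ball c r `<=` O ->
  O x -> ~ O° x -> 0 < s -> r * s <= dist_to O (x + s *: (x - c)).
Proof.
move=> /convex_setP cO cr Ox nOx s0; apply: le_dist_to; first by exists x.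
move=> y Oy; rewrite leNgt; apply/negP => xy; apply: nOx.
set w := x + _ - y in xy; set rho := (r * s - `|w|) / (1 + s).
have s1 : 0 < 1 + s by rewrite addr_gt0 ?ltr01.
have rho0 : 0 < rho by rewrite divr_gt0// subr_gt0.
apply/nbhs_ballP; exists rho => // z; rewrite -ball_normE/= => xz.
pose t := (1 + s)^-1; pose b := s^-1 *: ((1 + s) *: z - y).
rewrite (_ : z = t *: y + (1 - t) *: b); last first.
  by apply/rowP => i; rewrite !mxE /t; field; rewrite !gt_eqF.
apply: cO => //; last by rewrite invr_ge0 ltW//= invf_le1// lerDl ltW.
apply: cr; rewrite -ball_normE/=.
rewrite (_ : c - b = s^-1 *: ((1 + s) *: (x - z) - w)); last first.
  by apply/rowP => i; rewrite !mxE; field; rewrite gt_eqF.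
rewrite normrZ gtr0_norm ?invr_gt0// ltr_pdivrMl//.
apply: le_lt_trans (ler_normB _ _) _; rewrite normrZ (gtr0_norm s1).
by rewrite -ltrBrDr (mulrC s) (mulrC (1 + s)) -ltr_pdivlMr.
Qed.

(** The slopes of the distance at [x] are at least [r] outwards and at most 0
    inwards. *)
Lemma dist_to_kink O x c : convex_set O -> O° c -> O x -> ~ O° x ->
  kink (dist_to O) (x - c) x.
Proof.
move=> cO /nbhs_ballP[r /= r0 cr] Ox nOx /cvgrPdist_lt/(_ _ r0)[N _ /(_ N (leqnn N))].
set s : R := N.+1%:R^-1; have s0 : 0 < s by rewrite invr_gt0.
apply/negP; rewrite -leNgt sub0r normrN.
have d0 z : 0 <= dist_to O z by apply: le_dist_to; first by exists x.
have dx : dist_to O x = 0.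
  by apply/eqP; rewrite eq_le d0 andbT -(normr0 'rV[R]_n) -(subrr x) dist_to_le.
apply: le_trans (ler_norm _); rewrite /slope_gap /slope dx !subr0 invrN mulrN opprK.
apply: (@le_trans _ _ (dist_to O (x + s *: (x - c)) / s)).
  by rewrite ler_pdivlMr//; exact: dist_to_ge_boundary.
by rewrite lerDl divr_ge0 // ltW.
Qed.

(** The direction of the kink varies with the boundary point; this is harmless,
    since a kink in any direction excludes differentiability. *)
Theorem ae_interior O : convex_set O -> O° !=set0 ->
  {ae lebesgue_rV n, forall x, O x -> O° x}.
Proof.
move=> cO [c Oc]; have O0 : O !=set0 by exists c; exact: interior_subset.
have md := continuous_measurable_rV (continuous_dist_to O0).
apply: filterS (ae_differentiable md (convex_dist_to O0 cO)) => x dx Ox.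
rewrite interiorT in dx; apply: contrapT => nOx.
exact: (differentiable_no_kink (dx I) (dist_to_kink cO Oc Ox nOx)).
Qed.

End boundary.

(** * The class of closed convex functions with a given domain *)

Lemma cvg_rV (R : realType) (n : nat) (T : Type) (F : set_system T) (FF : Filter F)
    (v_ : T -> 'rV[R]_n) (v : 'rV[R]_n) :
  (forall i, v_ t 0 i @[t --> F] --> v 0 i) -> v_ @ F --> v.
Proof.
move=> vv; apply/cvgrPdist_lt => eps eps0.
have : \forall t \near F, forall i, `|v 0 i - v_ t 0 i| < eps.
  by apply: filter_forall => i; have /cvgrPdist_lt := vv i; exact.
apply: filterS => t H; rewrite [ltLHS]mx_normrE; apply: bigmax_lt => // -[i j] _ /=.
by rewrite !mxE ord1; exact: H.
Qed.

Lemma compact_measurable_rV (R : realType) (n : nat) (K : set 'rV[R]_n) :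
  compact K -> measurable K.
Proof.
move=> cK; rewrite -[K]setCK; apply: measurableC; apply: open_measurable_rV.
by apply: closed_openC; exact: compact_closed (@norm_hausdorff R 'rV[R]_n) cK.
Qed.

Lemma compact_lebesgue_rV_lty (R : realType) (n : nat) (K : set 'rV[R]_n) :
  compact K -> (lebesgue_rV n K < +oo)%E.
Proof.
move=> cK; have mK := compact_measurable_rV cK.
have [M [_ KM]] := compact_bounded cK.
pose b := `|M| + 1; pose B := [set v : 'rV[R]_n | forall i, `[- b, b]%classic (v 0 i)].
have KB : K `<=` B.
  move=> v /(KM b) vb i /=; rewrite in_itv/= -ler_norml.
  apply: le_trans (normr_coord_le _ _) (vb _).
  by rewrite /b (le_lt_trans (ler_norm M))// ltrDl.
have mI (i : 'I_n) : measurable `[- b, b]%classic by exact: measurable_itv.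
apply: (@le_lt_trans _ _ (lebesgue_rV n B)).
  by apply: le_measure => //; rewrite inE//; exact: (@measurable_rV_box R n (fun=> `[- b, b]%classic)).
rewrite /B (@lebesgue_rV_box R n (fun=> `[- b, b]%classic))//.
rewrite lebesgue_measure_itv /= lte_fin.
by case: ifP => _; rewrite ?EFinN -?EFinD prodEFin ltry.
Qed.

Section closed_convex_class.
Context {R : realType} {n : nat} (O : set 'rV[R]_n) (M : R) (u : 'rV[R]_n -> \bar R).
Hypothesis uO : closed_convex_class O M u.

Lemma class_fin_num x : (u x \is a fin_num) <-> O x.
Proof.
have [[uNy <-] _ _ _ _] := uO; rewrite /effective_dom /= fin_numE uNy/= ltey.
by split.
Qed.

Lemma class_convex_on : convex_on O (fine \o u).
Proof.
have [_ _ cu _ _] := uO; move=> x y t Ox Oy t01.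
have := cu x y t t01.
have /class_fin_num/fineK <- := Ox; have /class_fin_num/fineK <- := Oy.
rewrite -!EFinM -EFinD => uxy.
have /fineK uE : u (t *: x + (1 - t) *: y) \is a fin_num.
  have [[uNy _] _ _ _ _] := uO.
  by rewrite fin_numE uNy/= -ltey (le_lt_trans uxy)// ltry.
by rewrite -lee_fin /= uE.
Qed.

Lemma class_measurable : measurable_fun setT (fine \o u).
Proof.
have [_ lu _ _ _] := uO; apply: measurableT_comp; first exact: fine_measurable.
apply: (measurability _ (ErealGenOInfty.measurableE R)) => /= _ [_ [a ->]] <-.
rewrite setTI; apply: open_measurable_rV.
by rewrite preimage_itvoy; move/lower_semicontinuousP : lu; exact.
Qed.

(** Finiteness near [x] means that [x] is interior to the domain [O]. *)
Lemma edifferentiableP x :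
  edifferentiable u x <-> O° x /\ differentiable (fine \o u) x.
Proof.
rewrite /edifferentiable; split => -[Ox dux]; split => //.
  by apply: filterS Ox => y /class_fin_num.
by apply: filterS Ox => y /class_fin_num.
Qed.

Lemma ae_edifferentiable : convex_set O -> O° !=set0 ->
  {ae lebesgue_rV n, forall x, O x -> edifferentiable u x}.
Proof.
move=> cO O0; apply: filterS2 (ae_interior cO O0)
  (ae_differentiable class_measurable class_convex_on) => x Ox dx xO.
by apply/edifferentiableP; split; [exact: Ox|exact/dx/Ox].
Qed.

Lemma measurable_edifferentiable : measurable [set x | edifferentiable u x].
Proof.
rewrite (_ : mkset _ = O° `&` \bigcap_(i in [set: 'I_n])
    ~` [set x | kink (fine \o u) (delta_mx 0 i) x]).
  apply: measurableI; first by apply: open_measurable_rV; exact: open_interior.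
  apply: fin_bigcap_measurable => // i _; apply: measurableC.
  exact: measurable_kink class_measurable.
apply/seteqP; split => [x /edifferentiableP[Ox dx]|x [Ox nk]].
  by split => // i _; exact: differentiable_no_kink.
apply/edifferentiableP; split => //.
by apply: (no_kink_differentiable class_convex_on Ox) => i; exact: nk.
Qed.

Lemma egradientE x i : edifferentiable u x ->
  egradient u x 0 i = 'd (fine \o u) x (delta_mx 0 i : 'rV[R]_n).
Proof. by move=> dx; rewrite /egradient asboolT// mxE. Qed.

(** On the points of differentiability the composite is a pointwise limit of Borel
    functions; on the rest of [O] it is the constant [f 0]. *)
Lemma measurable_comp_egradient (f : 'rV[R]_n -> R) : measurable O -> continuous f ->
  measurable_fun O (f \o egradient u).
Proof.
move=> mO cf; pose D := [set x | edifferentiable u x].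
have mD : measurable D := measurable_edifferentiable.
have DO : D `<=` O by move=> x /edifferentiableP[/interior_subset].
rewrite -(setDUK DO) setUC; apply/measurable_funU => //; first exact: measurableD.
split.
  apply: (eq_measurable_fun (cst (f 0))) => [x|]; last exact: measurable_cst.
  by rewrite inE => -[_ nDx]; rewrite /= /egradient asboolF.
pose G m x : 'rV[R]_n := \row_i slope (fine \o u) (delta_mx 0 i) x m.+1%:R^-1.
apply: (@measurable_fun_cvg _ _ _ _ (fun m => f \o G m)) => [m|x Dx].
  apply: measurable_funTS; apply: measurableT_comp.
    exact: continuous_measurable_rV.
  apply/measurable_fun_rVP => i.
  apply: (eq_measurable_fun (fun x => slope (fine \o u) (delta_mx 0 i) x m.+1%:R^-1)).
    by move=> x _; rewrite mxE.
  exact: measurable_slope class_measurable.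
apply: (continuous_cvg _ (cf _)); apply: cvg_rV => i; rewrite egradientE//.
under eq_fun do rewrite mxE.
by apply: cvg_slope_invS; have /edifferentiableP[] := Dx.
Qed.

End closed_convex_class.

Lemma cvg_egradient (R : realType) (n : nat) (O : set 'rV[R]_n) (M : R)
    (u_ : nat -> 'rV[R]_n -> \bar R) (u : 'rV[R]_n -> \bar R) (x : 'rV[R]_n) :
  (forall k, closed_convex_class O M (u_ k)) -> closed_convex_class O M u ->
  (forall y, O° y -> u_ k y @[k --> \oo] --> u y) ->
  (forall k, edifferentiable (u_ k) x) -> edifferentiable u x ->
  egradient (u_ k) x @[k --> \oo] --> egradient u x.
Proof.
move=> u_O uO u_u du_ du; apply: cvg_rV => i; rewrite egradientE//.
under eq_fun do rewrite egradientE//.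
have /(edifferentiableP uO)[Ox dx] := du.
apply: (@cvg_diff _ _ O) => //.
- by move=> k; exact: class_convex_on (u_O k).
- by move=> k; have /(edifferentiableP (u_O k))[] := du_ k.
- move=> y Oy; apply: fine_cvg; rewrite fineK; first exact: u_u.
  by apply/(class_fin_num uO); exact: interior_subset.
Qed.

Lemma ae_foralln d (T : measurableType d) (R : realType)
    (mu : {measure set T -> \bar R}) (P : nat -> T -> Prop) :
  (forall k, {ae mu, forall x, P k x}) -> {ae mu, forall x, forall k, P k x}.
Proof.
move=> aeP; apply: negligibleS (negligible_bigcup aeP) => x /= /existsNP[k nP].
by exists k.
Qed.

Theorem theorem2 (R : realType) (n : nat) (Omega : set 'rV[R]_n) (M : R)
    (u_ : nat -> 'rV[R]_n -> \bar R) (u : 'rV[R]_n -> \bar R)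
    (f : 'rV[R]_n -> R)
    (Omega_convex : convex_set Omega) (Omega_compact : compact Omega)
    (Omega_interior : Omega° !=set0) (M_ge0 : 0 <= M)
    (u_class : forall k, closed_convex_class Omega M (u_ k))
    (u_class_lim : closed_convex_class Omega M u)
    (u_cvg : forall x, Omega° x -> (fun k => u_ k x) @ \oo --> u x)
    (f_bounded : bounded_fun f) (f_continuous : continuous f) :
  [/\ forall k, {ae lebesgue_rV n, forall x, Omega x -> edifferentiable (u_ k) x}
                /\ (lebesgue_rV n).-integrable Omega
                     (fun x => (f (egradient (u_ k) x))%:E),
      {ae lebesgue_rV n, forall x, Omega x -> edifferentiable u x}
        /\ (lebesgue_rV n).-integrable Omega
             (fun x => (f (egradient u x))%:E)
    & (fun k => \int[lebesgue_rV n]_(x in Omega) (f (egradient (u_ k) x))%:E)%E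
        @ \oo -->
      (\int[lebesgue_rV n]_(x in Omega) (f (egradient u x))%:E)%E].
Proof.
have mOmega := compact_measurable_rV Omega_compact.
have Omega_lty := compact_lebesgue_rV_lty Omega_compact.
have ae v : closed_convex_class Omega M v ->
    {ae lebesgue_rV n, forall x, Omega x -> edifferentiable v x}.
  by move=> vO; exact: ae_edifferentiable vO Omega_convex Omega_interior.
have int v : closed_convex_class Omega M v ->
    (lebesgue_rV n).-integrable Omega (fun x => (f (egradient v x))%:E).
  move=> vO; apply: (measurable_bounded_integrable (f := f \o egradient v)) => //.
    exact: measurable_comp_egradient vO _ _ _.
  have [B [Br fB]] := f_bounded; exists B; split => // b Bb x _; exact: fB.
split => [k||]; [by split; [exact: ae|exact: int]|by split; [exact: ae|exact: int]|].
have [B [_ fB]] := f_bounded.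
have aeall : {ae lebesgue_rV n, forall x, forall k, Omega x -> edifferentiable (u_ k) x}.
  by apply/ae_foralln => k; exact: ae.
have [] // := @dominated_convergence _ _ _ (lebesgue_rV n) Omega mOmega
  (fun k x => (f (egradient (u_ k) x))%:E) (fun x => (f (egradient u x))%:E)
  (cst (B + 1)%:E).
- by move=> k; apply/measurable_EFinP; exact: measurable_comp_egradient (u_class k) _ _ _.
- by apply/measurable_EFinP; exact: measurable_comp_egradient u_class_lim _ _ _.
- apply: filterS2 aeall (ae _ u_class_lim) => x du_ du Ox.
  apply: cvg_EFin; first exact: nearW.
  apply: (continuous_cvg _ (f_continuous _)).
  apply: (cvg_egradient u_class u_class_lim u_cvg); last exact: du.
  by move=> k; exact: du_.
- apply: (measurable_bounded_integrable (f := cst (B + 1))) => //.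
  by exists `|B + 1|; split => [|b /ltW Bb x _]; [exact: num_real|].
- by apply: aeW => x k _ /=; rewrite lee_fin; apply: fB => //; rewrite ltrDl.
Qed.
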